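(* Let $l(i)$ be the sample profit computed in iteration $i$ of the algorithm described in the context. In expectation, $l(i)$ is a lower bound to the total profit, i.e. $\mathbb{E}[l(i)]\le V_1(\mathbf 0)$ for all $i\in I\setminus\{0\}$.
   Context: **Dynamic program.** Let $X\subset\mathbb{Z}^n$ be the state set, with $\mathbf 0\in X$, and let $D\subset\mathbb{Z}^a\times\mathbb{R}^b$ be the decision set. Let $S=\{1,\dots,n\}$; for $s\in S$ let $1_s$ be the $s$-th standard unit vector, and let $1_0:=\mathbf 0$. Put $Y_+(x):=\{x+1_s\}_{s\in S\cup\{0\}}$. Let $P_{x,y}(d)\ge 0$ be transition probabilities with $\sum_{y\in Y_+(x)}P_{x,y}(d)=1$ for every $x$ and every $d\in D$. States never leave $X$: $P_{x,y}(d)=0$ if $x\in X$, $y\notin X$. All data and formulas below are also used at points of $\mathbb{Z}^n$ outside $X$ where needed. Let $T=\{1,\dots,\bar t\}$, and let $g:\mathbb{Z}^n\times\mathbb{Z}^n\times(\mathbb{Z}^a\times\mathbb{R}^b)\to\mathbb{R}$ (stage revenue) and $C:\mathbb{Z}^n\to\mathbb{R}$ (terminal cost) be given. The Bellman operator is $$(\mathcal{T}f)(x)=\max_{d\in D}\sum_{y\in Y_+(x)}P_{x,y}(d)\bigl(g(x,y,d)+f(y)\bigr),$$ where all maxima are assumed to be attained. If $f\equiv+\infty$, then $\mathcal{T}f\equiv+\infty$ and every $d\in D$ counts as a maximiser. The exact value functions are $V_{\bar t+1}=-C$ and $V_t=\mathcal{T}V_{t+1}$ for $t\in T$. **Submodularity.**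 A function $f$ satisfies the submodularity inequality at $y,z\in\mathbb{Z}^n$ if $f(\max(y,z))+f(\min(y,z))\le f(y)+f(z)$ (elementwise max/min). **Algorithm.** Let $i_{\max}\in\mathbb{N}$ and $I=\{0,1,\dots,i_{\max}\}$. The approximation is $Q_t^i(x)=\min_{j\in\{0,\dots,i\}}H_t^j(x)$ for $t\in T$, where each $H_t^j$ is an affine function $\langle a_t^j,x\rangle+b_t^j$ (or the constant $+\infty$). Initialise $H_t^0=Q_t^0\equiv+\infty$ for $t\in T$, and set $Q_{\bar t+1}^i=H_{\bar t+1}^i=-C$ for all $i\in I$. Let $J_t^i(x)=\operatorname{argmin}_{j\in\{0,\dots,i\}}H_t^j(x)$. For $i=1,\dots,i_{\max}$ do the following. 1. Forward sweep: set $x_1^i=\mathbf 0$. For $t=1,\dots,\bar t$ choose $d_t^i\in\operatorname{argmax}_{d\in D}\sum_{y\in Y_+(x_t^i)}P_{x_t^i,y}(d)\,(g(x_t^i,y,d)+Q_{t+1}^{i-1}(y))$ and sample $x_{t+1}^i\in Y_+(x_t^i)$ from the distribution $P_{x_t^i,\cdot}(d_t^i)$. Set $l(i)=\sum_{t=1}^{\bar t}g(x_t^i,x_{t+1}^i,d_t^i)-C(x_{\bar t+1}^i)$. 2. Backward sweep: for $t=\bar t,\bar t-1,\dots,1$ let $w=x_{t+1}^i$ and $Z(w)=\{w+1_s+1_{s'}\}_{s,s'\in S\cup\{0\}}$. If $Q_{t+1}^{i-1}$ satisfies the submodularity inequality for all pairs $y,y'\in Z(w)$ with $y\neq y'$ (taken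 to hold if $Q_{t+1}^{i-1}\equiv+\infty$), let $H^*$ be the unique affine function with $H^*(y)=(\mathcal{T}Q_{t+1}^{i-1})(y)$ for all $y\in Y_+(w)$ (the constant $+\infty$ if $Q_{t+1}^{i-1}\equiv+\infty$). Otherwise choose $j^*\in\operatorname{argmin}_{j\in J_{t+1}^{i-1}(w)}(\mathcal{T}H_{t+1}^j)(w)$ and let $H^*=\mathcal{T}H_{t+1}^{j^*}$ (as in the representation above, $H^*$ is required to be affine). Set $H_t^i=H^*$ and $Q_t^i=\min\{H^*,Q_t^{i-1}\}$. 3. Set $u(i)=Q_1^i(\mathbf 0)$. The expectation is over the random sampling in the algorithm. *)

(* Defs.v *)
(* MathComp-Analysis: real numbers are an arbitrary R : realType. *)
From HB Require Import structures.
From mathcomp Require Export all_boot all_order all_algebra.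
From mathcomp Require Export all_classical all_reals all_analysis.

Set Implicit Arguments.
Unset Strict Implicit.
Unset Printing Implicit Defensive.

Import Order.TTheory GRing.Theory Num.Theory.

Local Open Scope classical_set_scope.
Local Open Scope ring_scope.
Local Open Scope ereal_scope.

Definition state (n : nat) : Type := 'rV[int]_n.

Definition decision (R : realType) (a b : nat) : Type :=
  ('rV[int]_a * 'rV[R]_b)%type.

(* The index set S ∪ {0} is [option 'I_n]: [None] plays the role of 0. Since
   the 1_s are pairwise distinct, a sum over y in Y_+(x) is a sum over s with
   y = x + 1_s. *)
Definition unit_vec (n : nat) (s : option 'I_n) : state n :=
  if s is Some k then delta_mx ord0 k else 0%R.

Definition succ_state (n : nat) (x : state n) (s : option 'I_n) : state n :=
  (x + unit_vec s)%R.

Record dynprog (R : realType) (n a b : nat) := DynProg {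
  states : set (state n);
  decisions : set (decision R a b);
  trans : state n -> state n -> decision R a b -> R;
  revenue : state n -> state n -> decision R a b -> R;
  terminal_cost : state n -> R;
  horizon : nat;
  states0 : states 0%R;
  trans_ge0 : forall x y d, decisions d -> (0 <= trans x y d)%R;
  trans_sum1 : forall x d, decisions d ->
    (\sum_(s : option 'I_n) trans x (succ_state x s) d = 1)%R;
  trans_closed : forall x y d, decisions d ->
    states x -> ~ states y -> trans x y d = 0%R
}.

Definition is_stage (R : realType) (n a b : nat) (M : dynprog R n a b)
  (t : nat) : Prop := (1 <= t <= horizon M)%N.

(* Functions on the states are extended real valued to accommodate the
   constant +oo. As 0 * +oo = 0 and the probabilities sum to 1, the expression
   below is +oo for every d in D if f is constantly +oo; hence T f is then
   constantly +oo and every d in D is a maximiser. *)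
Definition lookahead (R : realType) (n a b : nat) (M : dynprog R n a b)
    (f : state n -> \bar R) (x : state n) (d : decision R a b) : \bar R :=
  \sum_(s : option 'I_n)
    (trans M x (succ_state x s) d)%:E *
    ((revenue M x (succ_state x s) d)%:E + f (succ_state x s)).

Definition maximiser (R : realType) (n a b : nat) (M : dynprog R n a b)
    (f : state n -> \bar R) (x : state n) (d : decision R a b) : Prop :=
  decisions M d /\
  forall d', decisions M d' -> lookahead M f x d' <= lookahead M f x d.

(* The maximum in (T f)(x) is attained for every x. *)
Definition max_attained (R : realType) (n a b : nat) (M : dynprog R n a b)
    (f : state n -> \bar R) : Prop :=
  forall x, exists d, maximiser M f x d.

(* The supremum is a maximum under [max_attained M f]. *)
Definition bellman (R : realType) (n a b : nat) (M : dynprog R n a b)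
    (f : state n -> \bar R) (x : state n) : \bar R :=
  ereal_sup [set lookahead M f x d | d in decisions M].

Definition terminal_value (R : realType) (n a b : nat) (M : dynprog R n a b)
    (x : state n) : \bar R :=
  (- terminal_cost M x)%:E.

(* V_t, computed by backward recursion with k = (horizon + 1) - t stages to
   go: V_(horizon + 1) = - C and V_t = T V_(t + 1) for 1 <= t <= horizon. *)
Definition value (R : realType) (n a b : nat) (M : dynprog R n a b)
    (t : nat) : state n -> \bar R :=
  iter ((horizon M).+1 - t) (bellman M) (terminal_value M).

Definition max_state (n : nat) (y z : state n) : state n :=
  \row_k Order.max (y ord0 k) (z ord0 k).

Definition min_state (n : nat) (y z : state n) : state n :=
  \row_k Order.min (y ord0 k) (z ord0 k).

Definition submodular_at (R : realType) (n : nat) (f : state n -> \bar R)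
    (y z : state n) : Prop :=
  f (max_state y z) + f (min_state y z) <= f y + f z.

Definition two_step_set (n : nat) (w : state n) : set (state n) :=
  [set y | exists s s' : option 'I_n,
    y = (w + unit_vec s + unit_vec s')%R].

(* This holds automatically if f is constantly +oo. *)
Definition locally_submodular (R : realType) (n : nat)
    (f : state n -> \bar R) (w : state n) : Prop :=
  forall y y', two_step_set w y -> two_step_set w y' -> y <> y' ->
    submodular_at f y y'.

Definition affine_fun (R : realType) (n : nat) (f : state n -> \bar R) : Prop :=
  exists (c : 'rV[R]_n) (c0 : R), forall x,
    f x = (\sum_(k < n) c ord0 k * (x ord0 k)%:~R + c0)%:E.

Definition constant_pinfty (R : realType) (n : nat)
    (f : state n -> \bar R) : Prop :=
  forall x, f x = +oo.

(* Q_t^i(x), the minimum of H_t^j(x) over 0 <= j <= i, where the argument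
   [H j] stands for H_t^j. *)
Definition min_upto (R : realType) (n : nat) (H : nat -> state n -> \bar R)
    (i : nat) (x : state n) : \bar R :=
  \big[Order.min/+oo]_(0 <= j < i.+1) H j x.

(* J_t^i(x) *)
Definition active (R : realType) (n : nat) (H : nat -> state n -> \bar R)
    (i : nat) (x : state n) : set nat :=
  [set j | (j <= i)%N /\ forall j', (j' <= i)%N -> H j x <= H j' x].

(* Hnew is a possible H^* at w, where [H j] stands for H_{t+1}^j and i for the
   number of completed iterations, so that [min_upto H i] is Q_{t+1}^i. *)
Definition backward_step (R : realType) (n a b : nat) (M : dynprog R n a b)
    (H : nat -> state n -> \bar R) (i : nat) (w : state n)
    (Hnew : state n -> \bar R) : Prop :=
  let Q := min_upto H i in
  (locally_submodular Q w ->
     (constant_pinfty Q -> constant_pinfty Hnew) /\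
     (~ constant_pinfty Q ->
        affine_fun Hnew /\
        forall s, Hnew (succ_state w s) = bellman M Q (succ_state w s))) /\
  (~ locally_submodular Q w ->
     exists j, [/\ active H i w j,
       (forall j', active H i w j' -> bellman M (H j) w <= bellman M (H j') w),
       (forall x, Hnew x = bellman M (H j) x) &
       affine_fun Hnew]).

(* The outcomes w and w' agree on all states sampled up to and including
   stage t of iteration i. *)
Definition same_history (R : realType) (n a b : nat) (M : dynprog R n a b)
    (Omega : Type) (x : nat -> nat -> Omega -> state n) (i t : nat)
    (w w' : Omega) : Prop :=
  forall k s, (1 <= k)%N -> (1 <= s <= (horizon M).+1)%N ->
    (k < i)%N || (k == i) && (s <= t)%N -> x k s w = x k s w'.

(* A run of imax iterations on a probability space (Omega, Pr): for an outcome
   w, [x i t w], [dec i t w] and [H i t w] are x_t^i, d_t^i and H_t^i. The only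
   randomness is the sampling of the successor states: the free choices (among
   several maximisers d_t^i or several minimisers j^* ) follow an arbitrary
   rule depending on the states sampled so far, which is what
   [run_dec_adapted] and [run_H_adapted] say. Since states are discrete, the
   conditional law of the next state given the past is expressed on the events
   of a fixed history, in [run_sampling]. *)
Record algorithm_run (R : realType) (n a b : nat) (M : dynprog R n a b)
    (disp : measure_display) (Omega : measurableType disp)
    (Pr : probability Omega R) (imax : nat)
    (x : nat -> nat -> Omega -> state n)
    (dec : nat -> nat -> Omega -> decision R a b)
    (H : nat -> nat -> Omega -> state n -> \bar R) : Prop := AlgorithmRun {
  run_measurable : forall i t y, (1 <= i <= imax)%N ->
    (1 <= t <= (horizon M).+1)%N -> measurable [set w | x i t w = y];
  run_H_terminal : forall i w y, (i <= imax)%N ->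
    H i (horizon M).+1 w y = terminal_value M y;
  run_H_init : forall t w, is_stage M t -> constant_pinfty (H 0%N t w);
  run_Q_attained : forall i t w, (1 <= i <= imax)%N -> is_stage M t ->
    max_attained M (min_upto (fun j => H j t.+1 w) i.-1);
  run_H_attained : forall i t w, (1 <= i <= imax)%N -> is_stage M t ->
    forall j, (j <= i.-1)%N -> max_attained M (H j t.+1 w);
  run_start : forall i w, (1 <= i <= imax)%N -> x i 1%N w = 0%R;
  run_dec : forall i t w, (1 <= i <= imax)%N -> is_stage M t ->
    maximiser M (min_upto (fun j => H j t.+1 w) i.-1) (x i t w) (dec i t w);
  run_dec_adapted : forall i t w w', (1 <= i <= imax)%N -> is_stage M t ->
    same_history M x i t w w' -> dec i t w = dec i t w';
  run_successor : forall i t w, (1 <= i <= imax)%N -> is_stage M t ->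
    exists s, x i t.+1 w = succ_state (x i t w) s;
  run_sampling : forall i t w0 s, (1 <= i <= imax)%N -> is_stage M t ->
    let y := succ_state (x i t w0) s in
    Pr [set w | same_history M x i t w0 w /\ x i t.+1 w = y] =
    Pr [set w | same_history M x i t w0 w] *
      (trans M (x i t w0) y (dec i t w0))%:E;
  run_backward : forall i t w, (1 <= i <= imax)%N -> is_stage M t ->
    backward_step M (fun j => H j t.+1 w) i.-1 (x i t.+1 w) (H i t w);
  run_H_adapted : forall i t w w', (1 <= i <= imax)%N -> is_stage M t ->
    same_history M x i (horizon M).+1 w w' -> H i t w = H i t w'
}.

(* l(i) *)
Definition sample_profit (R : realType) (n a b : nat) (M : dynprog R n a b)
    (Omega : Type) (x : nat -> nat -> Omega -> state n)
    (dec : nat -> nat -> Omega -> decision R a b) (i : nat) (w : Omega) : R :=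
  (\sum_(1 <= t < (horizon M).+1)
      revenue M (x i t w) (x i t.+1 w) (dec i t w)
   - terminal_cost M (x i (horizon M).+1 w))%R.

(* Main.v *)
Require Import Defs.
From mathcomp Require Import all_boot all_order all_algebra.
From mathcomp Require Import all_classical all_reals all_analysis.
From mathcomp Require Import zify.

(** The decisions taken in a forward sweep form a feasible policy, and no
    feasible policy earns more than V_1(0) in expectation, however its decisions
    are found: each d_t belongs to D and depends only on the states sampled
    so far.

    In iteration i, let E_t be the revenue collected before stage t plus
    V_t(x_t) ([expected_profit]), the profit that an optimal policy expects
    if it takes over at stage t. Given the history up to stage t, the state
    x_t and the decision d_t are known and x_(t+1) has law P_(x_t, .)(d_t).
    The conditional expectation of E_(t+1) is therefore the revenue before t
    plus the lookahead of V_(t+1) at (x_t, d_t), which is at most E_t because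
    V_t = T V_(t+1) maximises the lookahead over D. So the expectation of E_t
    is nonincreasing in t ([expected_profit_step]). It starts at V_1(0), as
    x_1 = 0, and ends at the expectation of l(i), as V_(horizon + 1) = - C.

    Each step of a sweep has only n + 1 possible successors, so there are
    finitely many histories. They are encoded by a random variable with values
    in a finite type ([history_code]); all expectations are then finite sums,
    and conditioning is summation over the values of the code
    ([expectation_conditional_step]). *)

Set Implicit Arguments.
Unset Strict Implicit.
Unset Printing Implicit Defensive.

Import Order.TTheory GRing.Theory Num.Theory.

Local Open Scope classical_set_scope.
Local Open Scope ring_scope.

(** * Expectations of finitely valued random variables *)

(** The default v0 serves as the value of phi outside the range of c. *)
Lemma factor_through (T K V : Type) (v0 : V) (c : T -> K) (F : T -> V) :
  (forall w w', c w = c w' -> F w = F w') ->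
  exists phi : K -> V, forall w, F w = phi (c w).
Proof.
move=> Fc.
exists (fun k => if pselect (exists w, c w = k) is left h
                 then F (projT1 (cid h)) else v0) => w.
case: pselect => [h|[]]; last by exists w.
by apply: Fc; case: cid.
Qed.

Lemma expectation_finite (R : realType) (disp : measure_display)
    (Omega : measurableType disp) (Pr : probability Omega R)
    (K : finType) (c : Omega -> K)
    (mc : forall k, measurable (c @^-1` [set k])) (phi : K -> R) :
  ('E_Pr[fun w => phi (c w)]
   = \sum_(k : K) (phi k)%:E * Pr (c @^-1` [set k]))%E.
Proof.
rewrite unlock.
transitivity (\int[Pr]_w (\sum_(k : K)
    (phi k)%:E * (\1_(c @^-1` [set k]) w)%:E)%E)%E.
  apply: eq_integral => w _.
  rewrite (bigD1 (c w))//= big1 ?adde0 => [|k kc].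
    by rewrite indicE mem_set// mule1.
  rewrite indicE memNset ?mule0//= => cwk.
  by rewrite cwk eqxx in kc.
rewrite integral_sum//=; last first.
  by move=> k; apply: integrableZl => //; exact: integrable_indic.
apply: eq_bigr => k _.
rewrite integralZl//; last exact: integrable_indic.
by rewrite integral_indic// setIT.
Qed.

(** A tower property: c is the known past, u the next observation, and p the
    conditional law of u given c. If the mean of psi (c, .) under p is at most
    phi (c), the expectations compare in the same way. The sum over the pairs
    (k, s) is grouped by k; the hypotheses only concern the values k that c
    takes, the other terms vanishing because their events are empty. *)
Lemma expectation_conditional_step (R : realType) (disp : measure_display)
    (Omega : measurableType disp) (Pr : probability Omega R)
    (K S : finType) (c : Omega -> K) (u : Omega -> S)
    (p : K -> S -> R) (phi : K -> R) (psi : K -> S -> R)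
    (mcu : forall k s, measurable [set w | c w = k /\ u w = s])
    (condP : forall w0 s, Pr [set w | c w = c w0 /\ u w = s]
      = (Pr [set w | c w = c w0] * (p (c w0) s)%:E)%E)
    (le_phi : forall w0, \sum_(s : S) p (c w0) s * psi (c w0) s <= phi (c w0)) :
  ('E_Pr[fun w => psi (c w) (u w)] <= 'E_Pr[fun w => phi (c w)])%E.
Proof.
have fibre2 k s : (fun w => (c w, u w)) @^-1` [set (k, s)]
    = [set w | c w = k /\ u w = s].
  by apply/seteqP; split=> w /=; [case=> <- <-|case=> -> ->].
have mc k : measurable (c @^-1` [set k]).
  rewrite (_ : c @^-1` [set k]
             = \bigcup_(s in [set: S]) [set w | c w = k /\ u w = s]).
    by apply: fin_bigcup_measurable => // s _.
  by apply/seteqP; split=> [w /= cw|w [s _ []]//]; exists (u w).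
rewrite (expectation_finite Pr mc).
have mcu2 ks : measurable ((fun w => (c w, u w)) @^-1` [set ks]).
  by case: ks => k s; rewrite fibre2.
rewrite (expectation_finite Pr mcu2 (fun ks => psi ks.1 ks.2)).
rewrite (eq_bigr (fun ks : K * S => (psi ks.1 ks.2)%:E
    * Pr [set w | c w = ks.1 /\ u w = ks.2])%E); last first.
  by case=> k s _; rewrite fibre2.
rewrite -(pair_bigA _ (fun k s => (psi k s)%:E
  * Pr [set w | c w = k /\ u w = s])%E)/=.
apply: lee_sum => k _.
have [[w0 <-]|no_k] := pselect (exists w0, c w0 = k); last first.
  rewrite big1 => [|s _].
    rewrite (_ : c @^-1` _ = set0) ?measure0 ?mule0//.
    by apply/seteqP; split=> w //= cw; case: no_k; exists w.
  rewrite (_ : [set w | _] = set0) ?measure0 ?mule0//.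
  by apply/seteqP; split=> w //= [cw _]; case: no_k; exists w.
have [q q0 qE] : exists2 q : R, 0 <= q & Pr [set w | c w = c w0] = q%:E.
  exists (fine (Pr [set w | c w = c w0])); first exact: fine_ge0.
  by rewrite fineK//; apply: fin_num_measure; exact: mc.
have -> : Pr (c @^-1` [set c w0]) = q%:E by exact: qE.
under eq_bigr do rewrite condP qE -!EFinM.
rewrite sumEFin -EFinM lee_fin [leRHS]mulrC.
rewrite (eq_bigr (fun s => q * (p (c w0) s * psi (c w0) s))); last first.
  by move=> s _; rewrite mulrC mulrA.
by rewrite -mulr_sumr ler_wpM2l.
Qed.

(** * The dynamic program *)

Lemma unit_vec_inj (n : nat) : injective (@unit_vec n).
Proof.
have delta_neq0 (k : 'I_n) : delta_mx ord0 k <> 0 :> 'rV[int]_n.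
  by move=> /rowP/(_ k); rewrite !mxE !eqxx.
move=> [k|] [l|] //= kl; last 2 first.
- by case: (delta_neq0 k).
- by case: (delta_neq0 l).
move/rowP: kl => /(_ k); rewrite !mxE !eqxx/=.
by case: eqVneq => [->//|_].
Qed.

Lemma succ_state_inj (n : nat) (y : state n) : injective (succ_state y).
Proof. by move=> u v /addrI /unit_vec_inj. Qed.

(** The sampled successor is recorded by its label in S or 0, which lives in a
    finite type, instead of by the state itself. *)
Definition step_label (n : nat) (y z : state n) : option 'I_n :=
  odflt None [pick u | z == succ_state y u].

Lemma succ_state_label (n : nat) (y z : state n) :
  (exists u, z = succ_state y u) -> succ_state y (step_label y z) = z.
Proof.
rewrite /step_label => -[u zE]; case: pickP => [v /eqP-> //|/(_ u)].
by rewrite zE eqxx.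
Qed.

Lemma step_label_succ (n : nat) (y : state n) (u : option 'I_n) :
  step_label y (succ_state y u) = u.
Proof. by apply: (@succ_state_inj _ y); rewrite succ_state_label//; exists u. Qed.

Lemma lookahead_fin (R : realType) (n a b : nat) (M : dynprog R n a b)
    (f : state n -> R) (y : state n) (d : decision R a b) :
  lookahead M (EFin \o f) y d = (\sum_(s : option 'I_n)
    trans M y (succ_state y s) d
      * (revenue M y (succ_state y s) d + f (succ_state y s)))%:E.
Proof. by rewrite -sumEFin; apply: eq_bigr => s _; rewrite EFinM EFinD. Qed.

Lemma lookahead_le_bellman (R : realType) (n a b : nat) (M : dynprog R n a b)
    (f : state n -> \bar R) (y : state n) (d : decision R a b) :
  decisions M d -> (lookahead M f y d <= bellman M f y)%E.
Proof. by move=> Dd; apply: ereal_sup_ubound; exists d. Qed.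

(** Attainment matters here: over an infinite decision set the supremum of
    finite lookaheads may be +oo, whereas a maximum is one of them. *)
Lemma bellman_fin_num (R : realType) (n a b : nat) (M : dynprog R n a b)
    (f : state n -> \bar R) (fmax : max_attained M f) :
  (forall y, f y \is a fin_num) -> forall y, bellman M f y \is a fin_num.
Proof.
move=> ffin y; have [d [Dd dmax]] := fmax y.
suff -> : bellman M f y = lookahead M f y d.
  rewrite (_ : f = EFin \o (fine \o f)) ?lookahead_fin//.
  by apply/funext => z /=; rewrite fineK.
apply/eqP; rewrite eq_le lookahead_le_bellman// andbT.
by apply: ge_ereal_sup => _ [d' Dd' <-]; exact: dmax.
Qed.

Lemma valueS (R : realType) (n a b : nat) (M : dynprog R n a b) (t : nat) :
  is_stage M t -> value M t = bellman M (value M t.+1).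
Proof. by move=> /andP[_ tT]; rewrite /value subSn// subSS. Qed.

Lemma value_fin_num (R : realType) (n a b : nat) (M : dynprog R n a b)
    (HV : forall t, is_stage M t -> max_attained M (value M t.+1)) (t : nat) :
  (1 <= t <= (horizon M).+1)%N -> forall y, value M t y \is a fin_num.
Proof.
have [k] := ubnP ((horizon M).+1 - t); elim: k t => // k IHk t tk tT.
have [tE|tM] := eqVneq t (horizon M).+1.
  by move=> y; rewrite tE /value subnn.
have t_stage : is_stage M t by rewrite /is_stage; lia.
move=> y; rewrite (valueS t_stage).
by apply: bellman_fin_num => //; [exact: HV|apply: IHk; lia].
Qed.

(** * Histories of a run *)

Definition sampled_before (i t k s : nat) : bool :=
  ((k < i) || (k == i) && (s <= t))%N.

(** The labels of all steps whose endpoint is sampled no later than stage t of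
    iteration i; the other entries are masked by [None]. Since every iteration
    starts at 0, these labels determine the history ([history_codeP]). Masking,
    rather than a shorter sequence, keeps the type independent of t. *)
Definition history_code (R : realType) (n a b : nat) (M : dynprog R n a b)
    (Omega : Type) (x : nat -> nat -> Omega -> state n) (i t : nat) (w : Omega) :
    {ffun 'I_i.+1 * 'I_(horizon M).+1 -> option 'I_n} :=
  [ffun q : 'I_i.+1 * 'I_(horizon M).+1 =>
     if [&& 1 <= q.1, 1 <= q.2 & sampled_before i t q.1 q.2.+1]%N
             then step_label (x q.1 q.2 w) (x q.1 q.2.+1 w) else None].

Section Run.
Context (R : realType) (n a b : nat) (M : dynprog R n a b)
  (disp : measure_display) (Omega : measurableType disp)
  (Pr : probability Omega R) (imax : nat)
  (x : nat -> nat -> Omega -> state n)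
  (dec : nat -> nat -> Omega -> decision R a b)
  (H : nat -> nat -> Omega -> state n -> \bar R)
  (Hrun : algorithm_run M Pr imax x dec H)
  (i : nat) (Hi : (1 <= i <= imax)%N).

Lemma history_codeP (t : nat) (w w' : Omega) :
  (1 <= t <= (horizon M).+1)%N ->
  (history_code M x i t w = history_code M x i t w')
  <-> same_history M x i t w w'.
Proof.
move=> tT; split=> [/ffunP code_eq k s k1|hist_eq].
  elim: s => // s IHs sT ks.
  have kimax : (1 <= k <= imax)%N by lia.
  have [s0|s_gt0] := posnP s; first by rewrite s0 !(run_start Hrun).
  have ks' : (k < i.+1)%N by lia.
  have sT' : (s < (horizon M).+1)%N by lia.
  have s_stage : is_stage M s by rewrite /is_stage; lia.
  have := code_eq (Ordinal ks', Ordinal sT').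
  rewrite !ffunE/= k1 s_gt0 /sampled_before ks/= => label_eq.
  rewrite -(succ_state_label (run_successor Hrun w kimax s_stage)).
  rewrite -(succ_state_label (run_successor Hrun w' kimax s_stage)).
  by rewrite label_eq IHs//; lia.
apply/ffunP => -[[k ki] [s sT]]; rewrite !ffunE/=.
case: ifP => // /and3P[k1 s1 ks].
by rewrite !hist_eq//; move: ks; rewrite /sampled_before; lia.
Qed.

(** A countable intersection of events that each fix one sampled state. *)
Lemma measurable_same_history (t : nat) (w0 : Omega) :
  measurable [set w | same_history M x i t w0 w].
Proof.
rewrite (_ : [set w | _] = \bigcap_k \bigcap_s
   [set w | (1 <= k)%N -> (1 <= s <= (horizon M).+1)%N ->
     sampled_before i t k s -> x k s w0 = x k s w]); last first.
  by apply/seteqP; split=> w hw k; [move=> _ s _|move=> s]; apply: hw.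
apply: bigcapT_measurable => k; apply: bigcapT_measurable => s.
have [/and3P[k1 sT ks]|none] :=
  boolP [&& 1 <= k, 1 <= s <= (horizon M).+1 & sampled_before i t k s]%N.
  rewrite (_ : [set w | _] = [set w | x k s w = x k s w0]).
    by apply: (run_measurable Hrun) => //; move: ks; rewrite /sampled_before; lia.
  by apply/seteqP; split=> w /=; [move=> h; rewrite h|move=> ->].
rewrite (_ : [set w | _] = setT)//; apply/seteqP; split=> w //= _ k1 sT ks.
by rewrite k1 sT ks in none.
Qed.

(** Translates events about codes and labels into the events for which the
    sampling rule gives the probabilities. *)
Lemma history_stepE (t : nat) (w0 : Omega) (s : option 'I_n) :
  is_stage M t ->
  [set w | history_code M x i t w = history_code M x i t w0
           /\ step_label (x i t w) (x i t.+1 w) = s]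
  = [set w | same_history M x i t w0 w
             /\ x i t.+1 w = succ_state (x i t w0) s].
Proof.
move=> t_stage; have tT : (1 <= t <= (horizon M).+1)%N.
  by move: t_stage; rewrite /is_stage; lia.
apply/seteqP; split=> w /=.
  move=> [/esym/(history_codeP _ _ tT) w0w <-]; split=> //.
  have -> : x i t w0 = x i t w by apply: w0w; lia.
  by rewrite succ_state_label//; exact: (run_successor Hrun).
move=> [w0w xE]; split; first by apply/esym/history_codeP.
rewrite xE (_ : x i t w0 = x i t w) ?step_label_succ//.
by apply: w0w; lia.
Qed.

Lemma measurable_history_step (t : nat) (k : {ffun _ -> _}) (s : option 'I_n) :
  is_stage M t ->
  measurable [set w | history_code M x i t w = k
                      /\ step_label (x i t w) (x i t.+1 w) = s].
Proof.
move=> t_stage; have [[w0 <-]|none] :=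
    pselect (exists w0, history_code M x i t w0 = k); last first.
  rewrite (_ : [set w | _] = set0)//.
  by apply/seteqP; split=> w // [wk _]; case: none; exists w.
rewrite history_stepE//; apply: measurableI.
  exact: measurable_same_history.
by apply: (run_measurable Hrun) => //; move: t_stage; rewrite /is_stage; lia.
Qed.

Definition revenue_before (t : nat) (w : Omega) : R :=
  \sum_(1 <= s < t) revenue M (x i s w) (x i s.+1 w) (dec i s w).

Definition expected_profit (t : nat) (w : Omega) : R :=
  revenue_before t w + fine (value M t (x i t w)).

(** The supermartingale inequality, in expectation. *)
Lemma expected_profit_step
    (HV : forall t, is_stage M t -> max_attained M (value M t.+1)) (t : nat) :
  is_stage M t ->
  ('E_Pr[expected_profit t.+1] <= 'E_Pr[expected_profit t])%E.
Proof.
move=> t_stage; have [t1 tT] : (1 <= t)%N /\ (t <= horizon M)%N.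
  by move: t_stage => /andP.
have tT' : (1 <= t <= (horizon M).+1)%N by lia.
(* Everything known at stage t before sampling is a function of the code. *)
have [past pastE] : exists past : _ -> R * state n * decision R a b,
    forall w, (revenue_before t w, x i t w, dec i t w)
              = past (history_code M x i t w).
  apply: (factor_through (0, 0, (0, 0))) => w w' /(history_codeP _ _ tT') ww'.
  congr (_, _, _).
  - apply: eq_big_nat => s st.
    rewrite (ww' i s) ?(ww' i s.+1)//; try lia.
    rewrite (run_dec_adapted Hrun (w' := w'))//.
      by rewrite /is_stage; lia.
    by move=> k r k1 rT kr; apply: ww' => //; lia.
  - by apply: ww'; lia.
  - exact: (run_dec_adapted Hrun).
pose v r y := fine (value M r y).
have vE r : (1 <= r <= (horizon M).+1)%N -> value M r = EFin \o v r.
  by move=> rT; apply/funext => y /=; rewrite fineK//; exact: value_fin_num.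
pose p k s := let: (_, y, d) := past k in trans M y (succ_state y s) d.
pose phi k := let: (g, y, _) := past k in g + v t y.
pose psi k s := let: (g, y, d) := past k in let z := succ_state y s in
  g + (revenue M y z d + v t.+1 z).
have phiE : expected_profit t = fun w => phi (history_code M x i t w).
  by apply/funext => w; rewrite /phi -pastE.
have psiE : expected_profit t.+1 = fun w => psi (history_code M x i t w)
    (step_label (x i t w) (x i t.+1 w)).
  apply/funext => w; rewrite /psi -pastE succ_state_label; last first.
    exact: (run_successor Hrun).
  by rewrite /expected_profit /revenue_before big_nat_recr//= -addrA.
rewrite phiE psiE.
apply: (expectation_conditional_step (p := p)) => [k s|w0 s|w0].
- exact: measurable_history_step.
- rewrite history_stepE// (run_sampling Hrun)// /p -pastE; congr (Pr _ * _)%E.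
  apply/seteqP; split=> w /=; first by move/(history_codeP _ _ tT').
  by move=> /esym /(history_codeP _ _ tT').
- have Dd : decisions M (dec i t w0) by case: (run_dec Hrun w0 Hi t_stage).
  rewrite /p /psi /phi -pastE.
  under eq_bigr do rewrite mulrDr.
  rewrite big_split/= -mulr_suml trans_sum1// mul1r lerD2l.
  (* The revenue before t cancels; what remains is optimality of V_t at x_t. *)
  have := lookahead_le_bellman (value M t.+1) (x i t w0) Dd.
  rewrite -valueS// !vE ?lookahead_fin ?lee_fin//; lia.
Qed.

End Run.

Theorem proposition3 (R : realType) (n a b : nat) (M : dynprog R n a b)
    (HV : forall t : nat, is_stage M t -> max_attained M (value M t.+1))
    (disp : measure_display) (Omega : measurableType disp)
    (Pr : probability Omega R) (imax : nat)
    (x : nat -> nat -> Omega -> state n)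
    (dec : nat -> nat -> Omega -> decision R a b)
    (H : nat -> nat -> Omega -> state n -> \bar R)
    (Hrun : algorithm_run M Pr imax x dec H)
    (i : nat) (Hi : (1 <= i <= imax)%N) :
  ('E_Pr[sample_profit M x dec i] <= value M 1%N (0%R : state n))%E.
Proof.
have decreasing t : (t <= horizon M)%N ->
    ('E_Pr[expected_profit M x dec i t.+1]
     <= 'E_Pr[expected_profit M x dec i 1])%E.
  elim: t => // t IHt tT; apply: le_trans (IHt (ltnW tT)).
  exact: (expected_profit_step Hrun).
have -> : sample_profit M x dec i
    = expected_profit M x dec i (horizon M).+1.
  by apply/funext => w; rewrite /expected_profit /value subnn.
apply: le_trans (decreasing _ (leqnn _)) _.
have -> : expected_profit M x dec i 1 = cst (fine (value M 1 0)).
  apply/funext => w.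
  by rewrite /expected_profit /revenue_before big_geq// add0r (run_start Hrun).
by rewrite expectation_cst fineK//; apply: value_fin_num.
Qed.
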